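(* For $i,h\ge0$ let $C_i^{\le h}$ be the number of Dyck paths of semilength $i$ and height at most $h$, and let $C_{<i}^{\le h}(z)=\sum_{j=0}^{i-1}C_j^{\le h}z^j$. For $k\ge0$ define $A_i^k(x,q,z)$ for $0\le i\le k$ recursively by $A_k^k=1$ and, for $i<k$, $$A_i^k(x,q,z)=\frac{1}{1-z\bigl[(x-1)C_i^{\le k-i-1}q^iz^i+(q-1)C_{<i}^{\le k-i-1}(qz)+A_{i+1}^k(x,q,z)\bigr]}.$$ Then for every $k\ge0$, $F_{\{312,(k+1)k\cdots1\}}(x,q,z)=A_0^k(x,q,z)$.
   Context: A Dyck path of semilength $n$ is a lattice path from $(0,0)$ to $(2n,0)$ with steps $(1,1)$ and $(1,-1)$ never going below the $x$-axis; its height is the maximal $y$-coordinate reached. For permutations $\pi=\pi_1\cdots\pi_n\in\mathfrak{S}_n$ and $\sigma\in\mathfrak{S}_m$, $\pi$ contains $\sigma$ if there are indices $i_1<\dots<i_m$ such that $\pi_{i_1}\cdots\pi_{i_m}$ is in the same relative order as $\sigma$; otherwise $\pi$ avoids $\sigma$. $\mathfrak{S}_n(\Sigma)$ is the set of permutations in $\mathfrak{S}_n$ avoiding every pattern in $\Sigma$; here $(k+1)k\cdots1$ is the decreasing pattern of length $k+1$. $\mathrm{fp}(\pi)=|\{i:\pi_i=i\}|$, $\mathrm{exc}(\pi)=|\{i:\pi_i>i\}|$, and $F_\Sigma(x,q,z)=\sum_{n\ge0}\sum_{\pi\in\mathfrak{S}_n(\Sigma)}x^{\mathrm{fp}(\pi)}q^{\mathrm{exc}(\pi)}z^n$.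 *)

(* Defs.v *)
From HB Require Import structures.
From mathcomp Require Import all_boot all_order all_fingroup all_algebra.
From mathcomp Require Import boolp.

Set Implicit Arguments.
Unset Strict Implicit.
Unset Printing Implicit Defensive.

Import GRing.Theory.
Local Open Scope ring_scope.

Record fps (R : Type) := Fps { fps_coef : nat -> R }.

Notation "f `_[ n ]" := (fps_coef f n)
  (at level 3, n at level 200, left associativity, format "f `_[ n ]")
  : ring_scope.

HB.instance Definition _ (R : Type) := gen_eqMixin (fps R).
HB.instance Definition _ (R : Type) := gen_choiceMixin (fps R).

Lemma fpsP (R : Type) (f g : fps R) : (forall n, f`_[n] = g`_[n]) <-> f = g.
Proof.
split=> [|-> //]; case: f g => [f] [g] /= fg.
by congr Fps; apply/funext.
Qed.

Section FpsRing.
Variable R : comNzRingType.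
Implicit Types f g h : fps R.

Definition fps_const (c : R) : fps R := Fps (fun n => if n == 0%N then c else 0).
Definition fps_var : fps R := Fps (fun n => (n == 1%N)%:R).
Definition fps_opp f : fps R := Fps (fun n => - f`_[n]).
Definition fps_add f g : fps R := Fps (fun n => f`_[n] + g`_[n]).
Definition fps_mul f g : fps R :=
  Fps (fun n => \sum_(i < n.+1) f`_[i] * g`_[n - i]).

Fact fps_addA : associative fps_add.
Proof. by move=> f g h; apply/fpsP => n /=; rewrite addrA. Qed.
Fact fps_addC : commutative fps_add.
Proof. by move=> f g; apply/fpsP => n /=; rewrite addrC. Qed.
Fact fps_add0 : left_id (fps_const 0) fps_add.
Proof. by move=> f; apply/fpsP => n /=; rewrite if_same add0r. Qed.
Fact fps_addN : left_inverse (fps_const 0) fps_opp fps_add.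
Proof. by move=> f; apply/fpsP => n /=; rewrite if_same addNr. Qed.

HB.instance Definition _ :=
  GRing.isZmodule.Build (fps R) fps_addA fps_addC fps_add0 fps_addN.

Definition fps_trunc (n : nat) f : {poly R} := \poly_(i < n.+1) f`_[i].

Fact fps_mulE n f g m : (m <= n)%N ->
  (fps_mul f g)`_[m] = (fps_trunc n f * fps_trunc n g)`_m.
Proof.
move=> le_mn; rewrite coefM /=; apply: eq_bigr => i _.
rewrite !coef_poly !ltnS (leq_trans (leq_subr _ _) le_mn).
by rewrite (leq_trans _ le_mn) // -ltnS.
Qed.

Fact fps_mulC : commutative fps_mul.
Proof.
by move=> f g; apply/fpsP => n; rewrite !(@fps_mulE n) // mulrC.
Qed.

Fact fps_mulA : associative fps_mul.
Proof.
move=> f g h; apply/fpsP => n.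
transitivity ((fps_trunc n f * (fps_trunc n g * fps_trunc n h))`_n).
  rewrite coefM; apply: eq_bigr => i _.
  by rewrite coef_poly ltn_ord (@fps_mulE n) ?leq_subr.
rewrite mulrA coefM; apply: eq_bigr => i _.
by rewrite coef_poly ltnS leq_subr (@fps_mulE n) // -ltnS.
Qed.

Fact fps_mul1 : left_id (fps_const 1) fps_mul.
Proof.
move=> f; apply/fpsP => n /=; rewrite big_ord_recl /= mul1r subn0.
by rewrite big1 ?addr0 // => i _; rewrite mul0r.
Qed.

Fact fps_mulDl : left_distributive fps_mul fps_add.
Proof.
move=> f g h; apply/fpsP => n /=; rewrite -big_split /=.
by apply: eq_bigr => i _; rewrite mulrDl.
Qed.

Fact fps_1neq0 : fps_const 1 != 0.
Proof. by apply/eqP => /fpsP /(_ 0%N) /eqP; rewrite /= oner_eq0. Qed.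

HB.instance Definition _ := GRing.Zmodule_isComNzRing.Build (fps R)
  fps_mulA fps_mulC fps_mul1 fps_mulDl fps_1neq0.

(* The inverse of an invertible series is picked by choice (it is unique);
   following the MathComp convention, f^-1 = f if f is not invertible. *)
Definition fps_unit : pred (fps R) := fun f => `[< exists g, g * f = 1 >].
Definition fps_inv f : fps R :=
  if pselect (exists g, g * f = 1) is left e then projT1 (cid e) else f.

Fact fps_mulV : {in fps_unit, left_inverse 1 fps_inv *%R}.
Proof.
move=> f /asboolP uf; rewrite /fps_inv.
by case: pselect => // e; case: (cid e).
Qed.
Fact fps_unitP f g : g * f = 1 -> fps_unit f.
Proof. by move=> gf; apply/asboolP; exists g. Qed.
Fact fps_inv_out : {in [predC fps_unit], fps_inv =1 id}.
Proof.
move=> f; rewrite inE => /asboolP nuf; rewrite /fps_inv.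
by case: pselect.
Qed.

HB.instance Definition _ := GRing.ComNzRing_hasMulInverse.Build (fps R)
  fps_mulV fps_unitP fps_inv_out.

Lemma fps_coefD f g n : (f + g)`_[n] = f`_[n] + g`_[n]. Proof. by []. Qed.
Lemma fps_coefN f n : (- f)`_[n] = - f`_[n]. Proof. by []. Qed.
Lemma fps_coefM f g n :
  (f * g)`_[n] = \sum_(i < n.+1) f`_[i] * g`_[n - i].
Proof. by []. Qed.
Lemma fps_coef1 n : (1 : fps R)`_[n] = (n == 0%N)%:R.
Proof. by case: n. Qed.

Fact fps_const_is_zmod : zmod_morphism fps_const.
Proof.
by move=> a b; apply/fpsP => -[|n] /=; rewrite ?subr0.
Qed.
Fact fps_const_is_monoid : monoid_morphism fps_const.
Proof.
split=> // a b; apply/fpsP => n; rewrite fps_coefM big_ord_recl /= subn0.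
rewrite big1 ?addr0 => [|i _]; last by rewrite mul0r.
by case: n => //= n; rewrite mulr0.
Qed.
HB.instance Definition _ :=
  GRing.isZmodMorphism.Build R (fps R) fps_const fps_const_is_zmod.
HB.instance Definition _ :=
  GRing.isMonoidMorphism.Build R (fps R) fps_const fps_const_is_monoid.

Lemma fps_coef_varM f n :
  (fps_var * f)`_[n] = if n is m.+1 then f`_[m] else 0.
Proof.
rewrite fps_coefM; case: n => [|n]; first by rewrite big_ord1 mul0r.
rewrite !big_ord_recl /= mul0r add0r mul1r subSS subn0.
by rewrite big1 ?addr0 // => i _; rewrite mul0r.
Qed.

Lemma fps_unit_1subz f : 1 - fps_var * f \is a GRing.unit.
Proof.
pose u := fps_var * f; pose s n := \sum_(m < n.+1) u ^+ m.
have u_small m : forall n, (n < m)%N -> (u ^+ m)`_[n] = 0.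
  elim: m => // m IHm n lt_nm; rewrite exprS -mulrA fps_coef_varM.
  case: n lt_nm => // n; rewrite ltnS => lt_nm.
  rewrite fps_coefM big1 // => i _; rewrite IHm ?mulr0 //.
  exact: leq_ltn_trans (leq_subr _ _) lt_nm.
have s_stable m n : (m <= n)%N -> (s n)`_[m] = (s m)`_[m].
  elim: n => [|n IHn]; first by rewrite leqn0 => /eqP->.
  rewrite leq_eqVlt => /predU1P[-> //|lt_mn].
  by rewrite /s big_ord_recr fps_coefD u_small // addr0 IHn.
apply/unitrP; pose g : fps R := Fps (fun n => (s n)`_[n]); exists g.
suff gu : g * (1 - u) = 1 by split; last rewrite mulrC.
apply/fpsP => n.
have ->: (g * (1 - u))`_[n] = (s n * (1 - u))`_[n].
  rewrite !fps_coefM; apply: eq_bigr => i _.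
  by rewrite /= -(@s_stable i n) // -ltnS.
have ->: s n * (1 - u) = 1 - u ^+ n.+1.
  by rewrite mulrC -[LHS]opprK -mulNr opprB -subrX1 opprB.
by rewrite fps_coefD fps_coefN u_small // subr0.
Qed.

End FpsRing.

Notation "c %:S" := (fps_const c) (at level 2, left associativity,
  format "c %:S") : ring_scope.
Notation "'z" := (@fps_var _) (at level 0) : ring_scope.

(* A lattice path is the sequence of its steps: [true] stands for (1, 1) and
   [false] for (1, -1). *)
Definition ycoord (w : seq bool) (t : nat) : int :=
  (count id (take t w))%:Z - (count negb (take t w))%:Z.

Definition is_dyck (w : seq bool) : bool :=
  [forall t : 'I_(size w).+1, 0 <= ycoord w t] && (ycoord w (size w) == 0).

(* Only used on Dyck paths, where ordinates are nonnegative. *)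
Definition path_height (w : seq bool) : nat :=
  \max_(t < (size w).+1) `|ycoord w t|%N.

(* C_i^{<= h} *)
Definition dyck_le (h i : nat) : nat :=
  #|[set w : i.*2.-tuple bool | is_dyck w & (path_height w <= h)%N]|.

(* 'S_n acts on {0, .., n - 1} rather than {1, .., n}. *)
Definition contains (n m : nat) (p : 'S_n) (s : 'S_m) : bool :=
  [exists f : {ffun 'I_m -> 'I_n},
    [forall a : 'I_m, forall b : 'I_m, (a < b)%N ==> (f a < f b)%N]
    && [forall a : 'I_m, forall b : 'I_m, (p (f a) < p (f b))%N == (s a < s b)%N]].

Definition pattern := {m : nat & 'S_m}.

Definition avoiders (S : seq pattern) (n : nat) : {set 'S_n} :=
  [set p : 'S_n | all (fun s : pattern => ~~ contains p (tagged s)) S].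

Definition perm312 : 'S_3 := perm (@ord_pred_inj 3).
Definition pat312 : pattern := Tagged (fun m => 'S_m) perm312.

Definition pat_decr (m : nat) : pattern :=
  Tagged (fun m => 'S_m) (perm (@rev_ord_inj m)).

Lemma perm312E : [seq (val (perm312 i)).+1 | i <- enum 'I_3] = [:: 3; 1; 2]%N.
Proof.
rewrite -[RHS](congr1 (map S) (erefl : [seq ((i + 3).-1 %% 3)%N | i <- iota 0 3] = _)).
by rewrite -val_enum_ord -!map_comp; apply: eq_map => i /=; rewrite permE.
Qed.

Definition fp (n : nat) (p : 'S_n) : nat := #|[set i : 'I_n | p i == i]|.
Definition exc (n : nat) (p : 'S_n) : nat := #|[set i : 'I_n | (i < p i)%N]|.

Section GeneratingFunctions.
Variables (R : comNzRingType) (x q : R).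

Definition F_avoid (S : seq pattern) : fps R :=
  Fps (fun n => \sum_(p in avoiders S n) x ^+ fp p * q ^+ exc p).

(* C_{<i}^{<= h}(u) *)
Definition dyck_series_lt (h i : nat) (u : fps R) : fps R :=
  \sum_(j < i) (dyck_le h j)%:R * u ^+ j.

Definition A_step (k i : nat) (Anext : fps R) : fps R :=
  1 / (1 - 'z * ((x%:S - 1) * (dyck_le (k - i - 1)%N i)%:R * q%:S ^+ i * 'z ^+ i
                 + (q%:S - 1) * dyck_series_lt (k - i - 1)%N i (q%:S * 'z)
                 + Anext)).

(* [A_from k d i] unfolds the recursion d times from i; d = k - i reaches the
   base case A_k^k = 1. *)
Fixpoint A_from (k d i : nat) : fps R :=
  if d is d'.+1 then A_step k i (A_from k d' i.+1) else 1.

Definition A_series (k i : nat) : fps R := A_from k (k - i) i.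

Lemma A_diag k : A_series k k = 1.
Proof. by rewrite /A_series subnn. Qed.

Lemma A_rec k i : (i < k)%N -> A_series k i = A_step k i (A_series k i.+1).
Proof. by move=> lt_ik; rewrite /A_series -{1}(subnSK lt_ik). Qed.

End GeneratingFunctions.

Definition Zxq : comNzRingType := {poly {poly int}}.
Definition xvar : Zxq := ('X : {poly int})%:P.
Definition qvar : Zxq := 'X.

(* Main.v *)
(* A 312-avoiding permutation reads s' 0 t', where every entry of s' is smaller
   than every entry of t', so that its longest decreasing subsequence has length
   max (ld s + 1) (ld t) for the standardizations s, t of s', t'.  Weigh an entry
   v at position j by comparing v + i with j: t keeps the shift i, s gets the
   shift i + 1, and the entry 0, at position |s|, contributes x, q or 1 according
   to whether |s| = i, |s| < i or |s| > i.  Hence the generating function W_i^h of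
   the 312-avoiders with ld <= h satisfies W_i^h = 1 + z H W_i^h, where H differs
   from W_(i+1)^(h-1) only in degrees <= i; in these degrees every entry is an
   excedance for the shift i + 1, so the coefficients of W_(i+1)^(h-1) are
   q^m times the number of 312-avoiders of size m, which is the number of Dyck
   paths by the first-return decomposition.  Thus A_i^k = W_i^(k-i). *)
Require Import Defs.
From mathcomp Require Import all_boot all_fingroup all_algebra zify ring.

Set Implicit Arguments.
Unset Strict Implicit.
Unset Printing Implicit Defensive.

(** * Sums over uniquely decomposable objects *)

(** Shared by permutations and Dyck paths, which both split uniquely into two parts of sizes [m] and
    [n - m]. Since [sz] recovers [m] from the first part, pairs for different [m] never give the
    same object. *)
Lemma big_glue (T : eqType) (R : Type) (idx : R) (op : Monoid.com_law idx)
    (glue : T -> T -> T) (sz : T -> nat) (L L' : nat -> seq T) (S : seq T)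
    (n : nat) (F : T -> R) :
  uniq S -> (forall m, uniq (L m)) -> (forall m, uniq (L' m)) ->
  (forall m s, s \in L m -> sz s = m) ->
  (forall m m' s t s' t', s \in L m -> s' \in L m' ->
     glue s t = glue s' t' -> s = s' /\ t = t') ->
  (forall u, u \in S <-> exists m s t,
     [/\ m <= n, s \in L m, t \in L' (n - m) & u = glue s t]) ->
  \big[op/idx]_(u <- S) F u = \big[op/idx]_(m < n.+1)
    \big[op/idx]_(s <- L m) \big[op/idx]_(t <- L' (n - m)) F (glue s t).
Proof.
move=> uS uL uL' szL glueI memS.
pose P m := [seq (s, t) | s <- L m, t <- L' (n - m)].
pose l := [seq glue p.1 p.2 | m <- index_iota 0 n.+1, p <- P m].
suff lS : perm_eq S l.
  rewrite (perm_big _ lS) big_allpairs_dep big_mkord /=; apply: eq_bigr => m _.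
  by rewrite big_allpairs.
apply: uniq_perm => // [|u].
  apply: allpairs_uniq_dep; first exact: iota_uniq.
    move=> m _; apply: allpairs_uniq => //.
    by move=> [s t] [s' t'].
  pose st := [seq @Tagged nat m (fun=> (T * T)%type) p | m <- index_iota 0 n.+1, p <- P m].
  have st_L : {in st, forall p, (tagged p).1 \in L (tag p)}.
    by move=> _ /allpairsPdep[m [_ [_ /allpairsP[[s t] [Ls _ ->]] ->]]].
  move=> [m [s t]] [m' [s' t']] /st_L /= Ls /st_L /= Ls' e.
  have [es et] := glueI _ _ _ _ _ _ Ls Ls' e; subst s' t'.
  by have <- : m = m' by rewrite -(szL _ _ Ls) -(szL _ _ Ls').
apply/idP/allpairsPdep.
  move=> /memS[m [s [t [mn Ls Lt ->]]]]; exists m, (s, t).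
  by rewrite mem_index_iota; split=> //; apply/allpairsP; exists (s, t).
move=> [m [p [Hm /allpairsP[[s t] [/= Ls Lt ->]] ->]]]; apply/memS.
by exists m, s, t; move: Hm; rewrite mem_index_iota.
Qed.

(** * Permutations as words *)

Section Words.
Variable n : nat.
Implicit Type p : 'S_n.

(** One-line notation as a plain sequence, so that permutations of different sizes can be cut and
    glued within a single type. *)
Definition word p : seq nat := [seq val (p i) | i <- enum 'I_n].

Lemma size_word p : size (word p) = n.
Proof. by rewrite size_map size_enum_ord. Qed.

Lemma nth_word p (i : 'I_n) : nth 0 (word p) i = p i.
Proof. by rewrite (nth_map i) ?size_enum_ord // nth_ord_enum. Qed.

Lemma word_inj : injective word.
Proof.
move=> p p' e; apply/permP => i; apply/val_inj.
by move: (nth_word p i); rewrite e nth_word.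
Qed.

Lemma perm_word p : perm_eq (word p) (iota 0 n).
Proof.
rewrite -val_enum_ord /word (map_comp val p); apply: perm_map.
apply: uniq_perm; rewrite ?enum_uniq ?(map_inj_uniq perm_inj) ?enum_uniq //.
move=> i; rewrite mem_enum; apply/mapP; exists (p^-1 i)%g; rewrite ?mem_enum //.
by rewrite permKV.
Qed.

Lemma word_surj s : perm_eq s (iota 0 n) -> exists p, s = word p.
Proof.
move=> sn; have sz_s : size s = n by rewrite (perm_size sn) size_iota.
have lt_s (i : 'I_n) : nth 0 s i < n.
  have : nth 0 s i \in s by rewrite mem_nth // sz_s.
  by rewrite (perm_mem sn) mem_iota.
have f_inj : injective (fun i => Ordinal (lt_s i)).
  move=> i j [] /eqP; rewrite nth_uniq ?sz_s //; last by rewrite (perm_uniq sn) iota_uniq.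
  by move=> /eqP/val_inj.
exists (perm f_inj); apply: (@eq_from_nth _ 0) => [|i]; rewrite ?size_word // sz_s => lt_in.
by rewrite (nth_word _ (Ordinal lt_in)) permE.
Qed.

Lemma contains_word m p (s : 'S_m) :
  contains p s <-> exists u, [/\ subseq u (word p), size u = m &
    forall a b : 'I_m, (nth 0 u a < nth 0 u b) = (s a < s b)].
Proof.
have val_ltn_trans k : transitive (fun i j : 'I_k => i < j) by move=> ? ? ?; apply: ltn_trans.
have enum_sorted k : sorted (fun i j : 'I_k => i < j) (enum 'I_k).
  by have := iota_ltn_sorted 0 k; rewrite -val_enum_ord sorted_map.
split.
  move=> /existsP[f /andP[/forallP f_incr /forallP fs]].
  exists [seq val (p (f a)) | a <- enum 'I_m]; split; last 2 first.
  - by rewrite size_map size_enum_ord.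
  - have nth_u (c : 'I_m) : nth 0 [seq val (p (f a)) | a <- enum 'I_m] c = p (f c).
      by rewrite (nth_map c) ?size_enum_ord // nth_ord_enum.
    by move=> a b; rewrite !nth_u (eqP (forallP (fs a) b)).
  rewrite (map_comp (fun i => val (p i)) f); apply: map_subseq.
  (* The image of the increasing [f] and the filtered enumeration are strictly sorted with the same
     elements, hence equal. *)
  suff -> : map f (enum 'I_m) = filter (mem (map f (enum 'I_m))) (enum 'I_n).
    exact: filter_subseq.
  apply: (@irr_sorted_eq _ (fun i j : 'I_n => i < j)).
  - exact: val_ltn_trans.
  - by move=> i; rewrite /= ltnn.
  - rewrite sorted_map; apply: sub_sorted (enum_sorted m) => a b lt_ab /=.
    by have /forallP/(_ b)/implyP := f_incr a; apply.
  - exact: sorted_filter (@val_ltn_trans n) _ _ (enum_sorted n).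
  - by move=> i; rewrite mem_filter mem_enum andbT.
move=> [u [/subseqP[b _ ->]]]; rewrite -map_mask; set e := mask b _ => sz_e u_s.
have e_sorted : sorted (fun i j : 'I_n => i < j) e by exact: sorted_mask.
rewrite size_map in sz_e.
have [f fE] : exists f : {ffun 'I_m -> 'I_n}, forall a x0, f a = nth x0 e a.
  exists [ffun a : 'I_m => tnth (in_tuple e) (cast_ord (esym sz_e) a)] => a x0.
  by rewrite ffunE (tnth_nth x0).
apply/existsP; exists f; apply/andP; split; apply/forallP => a; apply/forallP => c;
  have x0 := f a.
  apply/implyP => lt_ac; rewrite !(fE _ x0).
  have := @sorted_ltn_nth _ (fun i j : 'I_n => i < j) (val_ltn_trans n) x0 _ e_sorted a c.
  by rewrite !inE !sz_e; apply.
by rewrite -u_s !(nth_map x0) ?sz_e // !(fE _ x0).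
Qed.

End Words.

(** * Pattern avoidance read on words *)

Definition avoids312 (s : seq nat) : Prop :=
  forall a b c, subseq [:: c; a; b] s -> a < b -> b < c -> False.

Definition dec_le (h : nat) (s : seq nat) : Prop :=
  forall u, subseq u s -> sorted gtn u -> size u <= h.

Lemma avoids312_word n (p : 'S_n) : avoids312 (word p) <-> ~~ contains p perm312.
Proof.
(* This sends 0, 1, 2 to 2, 0, 1, the pattern 312 with values counted from 0. *)
have E (a : 'I_3) : val (perm312 a) = (a + 3).-1 %% 3 by rewrite permE.
split.
  move=> av; apply/negP => /contains_word[u [sub sz_u H]].
  case: u sz_u sub H => [|c [|a [|b [|]]]] // _ sub H.
  have /= lt_ab := H (@Ordinal 3 1 isT) (@Ordinal 3 2 isT).
  have /= lt_bc := H (@Ordinal 3 2 isT) (@Ordinal 3 0 isT).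
  by apply: (av _ _ _ sub); rewrite ?lt_ab ?lt_bc !E.
move=> /negP nc a b c sub lt_ab lt_bc; apply: nc; apply/contains_word.
exists [:: c; a; b]; split=> // i j; rewrite !E.
by case: i j => [[|[|[|i]]] Hi] [[|[|[|j]]] Hj] //=; lia.
Qed.

Lemma dec_le_word n h (p : 'S_n) :
  dec_le h (word p) <-> ~~ contains p (tagged (pat_decr h.+1)).
Proof.
have E (a : 'I_h.+1) : val (tagged (pat_decr h.+1) a) = h.+1 - a.+1 by rewrite permE.
split.
  move=> dec; apply/negP => /contains_word[u [sub sz_u H]].
  suff /(dec u sub) : sorted gtn u by rewrite sz_u /= ltnn.
  apply/(sortedP 0) => i lt_i; rewrite sz_u /= in lt_i.
  have := H (Ordinal lt_i) (Ordinal (ltnW lt_i)); rewrite !E /= => ->.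
  lia.
move=> /negP nc u sub dec_u; case: leqP => // lt_hu; case: nc.
(* Any decreasing subsequence longer than [h], cut to its first [h.+1] entries, is an occurrence of
   the decreasing pattern. *)
apply/contains_word; exists (take h.+1 u).
have sz : size (take h.+1 u) = h.+1 by rewrite size_takel.
split=> //; first exact: subseq_trans (take_subseq _ _) sub.
have gtn_trans : transitive gtn by move=> ? ? ? /= ? ?; lia.
have := take_sorted h.+1 dec_u; move: (take _ _) sz => v sz dec_v a b; rewrite !E.
have nth_lt i j : i < j -> j < h.+1 -> nth 0 v j < nth 0 v i.
  move=> lt_ij lt_j; apply: (sorted_ltn_nth gtn_trans 0 dec_v) => //; rewrite inE sz //.
  exact: ltn_trans lt_j.
have lt_a : a < h.+1 := ltn_ord a; have lt_b : b < h.+1 := ltn_ord b.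
move: (nat_of_ord a) (nat_of_ord b) lt_a lt_b => {a b} a b lt_a lt_b.
case: (ltngtP a b) => [lt_ab | lt_ba | eq_ab].
- have := nth_lt _ _ lt_ab lt_b; lia.
- have := nth_lt _ _ lt_ba lt_a; lia.
- by rewrite eq_ab !ltnn.
Qed.

Lemma subseq_catP (T : eqType) (u s t : seq T) :
  subseq u (s ++ t) <->
  exists v w, [/\ u = v ++ w, subseq v s & subseq w t].
Proof.
split=> [/subseqP[m sz_m ->]|[v [w [-> sv tw]]]]; last exact: cat_subseq.
exists (mask (take (size s) m) s), (mask (drop (size s) m) t).
rewrite !mask_subseq -mask_cat ?cat_take_drop //.
by rewrite size_takel // sz_m size_cat leq_addr.
Qed.

Lemma subseq_mapP (T U : eqType) (f : T -> U) u s :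
  subseq u (map f s) -> exists2 v, subseq v s & u = map f v.
Proof. by move=> /subseqP[m _ ->]; exists (mask m s); rewrite ?mask_subseq // map_mask. Qed.

(** * Decomposition of a word at its entry 0 *)

(** Rebuilds a word from its standardized parts: if [s] permutes the values below [m], then the
    values 1 to [m] stand before the 0 and the larger ones after it. *)
Definition glue (s t : seq nat) : seq nat :=
  map succn s ++ 0 :: map (addn (size s).+1) t.

(** Once raised, the first part contains no 0, so the first 0 stands at index [size s] and shows
    where to cut. *)
Lemma glue_inj s t s' t' : glue s t = glue s' t' -> s = s' /\ t = t'.
Proof.
move=> e; have idx u v : index 0 (glue u v) = size u.
  rewrite /glue index_cat size_map /= addn0; case: ifP => // /mapP[] //.
have sz : size s = size s' by rewrite -(idx s t) e idx.
move/eqP: e; rewrite /glue eqseq_cat ?size_map // sz => /andP[/eqP e1 /eqP[e2]].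
by split; [apply: inj_map e1 => ? ? [] | apply: inj_map e2 => ? ? /addnI].
Qed.

Lemma perm_glue m n s t : m <= n ->
  perm_eq s (iota 0 m) -> perm_eq t (iota 0 (n - m)) ->
  perm_eq (glue s t) (iota 0 n.+1).
Proof.
move=> le_mn sm tn; rewrite /glue (perm_size sm) size_iota.
rewrite -cat1s perm_catCA /= perm_cons.
have -> : iota 1 n = map succn (iota 0 m) ++ map (addn m.+1) (iota 0 (n - m)).
  by rewrite -(iotaDl 1) -iotaDl addn0 addn0 -[m.+1]add1n -iotaD subnKC.
by apply: perm_cat; apply: perm_map.
Qed.

Section Glue.
Variables s t : seq nat.
Hypothesis lt_s : forall a, a \in s -> a < size s.
Let t' := map (addn (size s).+1) t.

Let mem_s' u a : subseq u (map succn s) -> a \in u -> a <= size s.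
Proof. by move=> /mem_subseq sub /sub /mapP[b /lt_s lt_b ->]. Qed.

Let mem_t' u a : subseq u (0 :: t') -> a \in u -> 0 < a -> size s < a.
Proof.
move=> /mem_subseq sub /sub; rewrite inE => /predU1P[-> //|/mapP[b _ ->]] _.
by rewrite addSn ltnS leq_addr.
Qed.

Let subseq_t' a u : 0 < a -> subseq (a :: u) (0 :: t') -> subseq (a :: u) t'.
Proof. by rewrite /=; case: eqP => // ->. Qed.

(** In an occurrence [c a b] of 312, [b] is positive and smaller than [c], so [b] cannot stand after
    the 0 when [c] stands before it. The occurrence thus lies in a single part. *)
Lemma avoids312_glue : avoids312 (glue s t) <-> avoids312 s /\ avoids312 t.
Proof.
split=> [av|[av_s av_t] a b c].
  split=> a b c sub lt_ab lt_bc.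
    apply: (av a.+1 b.+1 c.+1) => //; apply: subseq_trans (prefix_subseq _ _).
    exact: (map_subseq succn sub).
  pose f := addn (size s).+1; apply: (av (f a) (f b) (f c)); rewrite ?ltn_add2l //.
  apply: subseq_trans (suffix_subseq _ _).
  exact: subseq_trans (map_subseq f sub) (subseq_cons _ _).
move=> /subseq_catP[v [w [e sub_v sub_w]]] lt_ab lt_bc.
have b_w : b \in w -> c \in v -> False.
  move=> bw cv; have := mem_s' sub_v cv.
  by have := mem_t' sub_w bw (leq_ltn_trans (leq0n _) lt_ab); lia.
case: v e sub_v b_w => [/= e _ _|c1 [|a1 [|b1 [|d1 v]]]] /=.
- move: sub_w; rewrite -e => /subseq_t' sub_w.
  have {sub_w} := sub_w (leq_ltn_trans (leq0n _) lt_bc).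
  move=> /subseq_mapP[[|c' [|a' [|b' [|]]]]] // sub [ec ea eb].
  by apply: (av_t _ _ _ sub); lia.
- by move=> [-> <-] _; apply; rewrite !inE eqxx ?orbT.
- by move=> [-> _ <-] _; apply; rewrite !inE eqxx ?orbT.
- move=> [<- <- <- _] /subseq_mapP[[|c' [|a' [|b' [|]]]]] // sub [ec ea eb] _.
  by apply: (av_s _ _ _ sub); lia.
- by move=> [].
Qed.

(** A decreasing subsequence of the first part can be prolonged by the 0, and by nothing else, since
    all later entries are larger. *)
Lemma dec_le_glue h : dec_le h.+1 (glue s t) <-> dec_le h s /\ dec_le h.+1 t.
Proof.
split=> [dec|[dec_s dec_t] u].
  split=> u sub dec_u.
    have := dec (rcons (map succn u) 0); rewrite size_rcons size_map ltnS; apply.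
      rewrite -cats1; apply: cat_subseq; first exact: map_subseq.
      by rewrite sub1seq mem_head.
    case: u {sub} dec_u => //= a u; rewrite rcons_path path_map => -> /=.
    by rewrite last_map.
  rewrite -(size_map (addn (size s).+1)); apply: dec.
    apply: subseq_trans (suffix_subseq _ _).
    exact: subseq_trans (map_subseq _ sub) (subseq_cons _ _).
  rewrite sorted_map; apply: sub_sorted dec_u => a b /=; lia.
have gtn_trans : transitive gtn by move=> ? ? ? /= ? ?; lia.
move=> /subseq_catP[v [w [-> sub_v sub_w]]].
rewrite sorted_pairwise // pairwise_cat -!sorted_pairwise // => /and3P[lt_wv dec_v dec_w].
have le_vh : size v <= h.
  case/subseq_mapP: sub_v dec_v => v' sub ->; rewrite sorted_map size_map.
  exact: dec_s.
case: v lt_wv le_vh sub_v {dec_v} => [_ _ _|a v lt_wv le_vh sub_v].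
  (* With nothing taken before the 0, the subsequence is empty, is the 0 alone, or lies in the
     second part. *)
  case: w sub_w dec_w => // -[|b] w sub_w dec_w.
    by move: dec_w; rewrite /= path_sortedE // => /andP[]; case: (w).
  have := subseq_t' (ltn0Sn b) sub_w => /subseq_mapP[w' sub e].
  rewrite /= -/(size (b.+1 :: w)) e size_map; apply: dec_t => //.
  move: dec_w; rewrite e sorted_map; apply: sub_sorted => ? ? /=; lia.
rewrite size_cat -addn1 leq_add //.
(* The entries of [w] are distinct and all equal to 0, so there is at most one. *)
apply: (@uniq_leq_size _ w [:: 0]).
  by apply: sorted_uniq dec_w => // i; rewrite /= ltnn.
move=> b bw; rewrite inE eqn0Ngt; apply/negP => b_gt0.
have /allrelP/(_ a b (mem_head _ _) bw) /= := lt_wv.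
have := mem_t' sub_w bw b_gt0; have := mem_s' sub_v (mem_head _ _); lia.
Qed.

End Glue.

(** An entry [a] before the 0 and a smaller [b] after it would make [a 0 b] a 312, so the values
    before the 0 are the smallest positive ones. *)
Lemma unglue n s : perm_eq s (iota 0 n.+1) -> avoids312 s ->
  exists m u v, [/\ m <= n, perm_eq u (iota 0 m), perm_eq v (iota 0 (n - m))
                  & s = glue u v].
Proof.
move=> sn av; have : 0 \in s by rewrite (perm_mem sn).
have us : uniq s by rewrite (perm_uniq sn) iota_uniq.
move=> /splitPr s_pq; case: {s}_ / s_pq sn av us => p q sn av us.
move: sn; rewrite -cat1s perm_catCA /= perm_cons => pq_n.
have mem_pq a : a \in p ++ q -> 0 < a.
  by rewrite (perm_mem pq_n) mem_iota => /andP[].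
have lt_pq a b : a \in p -> b \in q -> a < b.
  move=> ap bq; rewrite ltnNge leq_eqVlt; apply/negP => /predU1P[eab|lt_ba].
    move: us; rewrite cat_uniq /= => /and3P[_ /norP[_ /hasPn/(_ b bq)]].
    by rewrite eab ap.
  have b_gt0 : 0 < b by apply: mem_pq; rewrite mem_cat bq orbT.
  apply: (av 0 b a) => //; apply: (@cat_subseq _ [:: a] [:: 0; b]).
    by rewrite sub1seq.
  by rewrite /= sub1seq.
pose m := size p; exists m.
have sz_n : n = m + size q by rewrite -size_cat (perm_size pq_n) size_iota.
(* Both sides are sorted lists of the values 1 to [n]; comparing their first [m] entries gives the
   values on each side of the 0. *)
have sort_pq : sort leq p ++ sort leq q = iota 1 m ++ iota m.+1 (n - m).
  rewrite -[m.+1]add1n -iotaD subnKC; last by rewrite sz_n leq_addr.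
  apply: (sorted_eq leq_trans anti_leq).
  - rewrite sorted_pairwise; last exact: leq_trans.
    rewrite pairwise_cat -!sorted_pairwise; try exact: leq_trans.
    rewrite !sort_sorted ?andbT; try exact: leq_total.
    apply/allrelP => a b; rewrite !mem_sort => ap bq.
    exact: ltnW (lt_pq _ _ ap bq).
  - exact: iota_sorted.
  - apply: perm_trans pq_n; apply: perm_cat; exact/permPl/perm_sort.
move/eqP: sort_pq; rewrite eqseq_cat ?size_sort ?size_iota // => /andP[/eqP sp /eqP sq].
have pm : perm_eq p (iota 1 m) by rewrite -sp perm_sym; apply/permPl/perm_sort.
have qm : perm_eq q (iota m.+1 (n - m)) by rewrite -sq perm_sym; apply/permPl/perm_sort.
exists (map predn p), (map (subn^~ m.+1) q); split.
- by rewrite sz_n leq_addr.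
- have := perm_map predn pm.
  by rewrite (iotaDl 1 0) -map_comp [X in perm_eq _ X]map_id_in.
- have := perm_map (subn^~ m.+1) qm.
  rewrite -[X in iota X _]addn0 iotaDl -map_comp [X in perm_eq _ X]map_id_in //.
  by move=> a _ /=; rewrite addKn.
rewrite /glue size_map -/m -!map_comp; congr (_ ++ _ :: _).
  rewrite map_id_in // => a ap /=; rewrite prednK // mem_pq //.
  by rewrite mem_cat ap.
rewrite map_id_in // => a; rewrite (perm_mem qm) mem_iota => /andP[le_ma _].
by rewrite /= subnKC.
Qed.

(** * Enumeration of the avoiders *)

Definition words (h n : nat) : seq (seq nat) :=
  [seq word p | p <- enum (avoiders [:: pat312; pat_decr h.+1] n)].

Lemma uniq_words h n : uniq (words h n).
Proof. by rewrite map_inj_uniq ?enum_uniq //; apply: word_inj. Qed.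

Lemma mem_words h n s :
  s \in words h n <-> [/\ perm_eq s (iota 0 n), avoids312 s & dec_le h s].
Proof.
have mem_av (p : 'S_n) : p \in avoiders [:: pat312; pat_decr h.+1] n <->
    avoids312 (word p) /\ dec_le h (word p).
  rewrite inE /= andbT avoids312_word dec_le_word.
  by split=> [/andP //|[-> ->]].
split=> [/mapP[p pA ->]|[/word_surj[p ->] av dec]].
  move: pA; rewrite mem_enum => /mem_av[av dec]; split=> //; exact: perm_word.
by apply/mapP; exists p => //; rewrite mem_enum; apply/mem_av.
Qed.

Lemma size_mem_words h n s : s \in words h n -> size s = n.
Proof. by move=> /mem_words[/perm_size -> _ _]; rewrite size_iota. Qed.

Lemma words_nil h : words h 0 = [:: [::]].
Proof.
apply: perm_small_eq => //; apply: uniq_perm; rewrite ?uniq_words // => s.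
rewrite inE; apply/idP/eqP => [/size_mem_words/size0nil //|->].
by apply/mem_words; split=> //= u; rewrite subseq0 => /eqP ->.
Qed.

Lemma words0S n : words 0 n.+1 = [::].
Proof.
case: (words _ _) (@mem_words 0 n.+1) => // s l /(_ s)[/(_ (mem_head _ _))].
move=> [sn _ dec] _; have : 0 \in s by rewrite (perm_mem sn).
by rewrite -sub1seq => /dec/(_ isT).
Qed.

(** The first part gets the bound [h] because the 0 can prolong its decreasing subsequences; the
    second keeps [h.+1]. *)
Lemma mem_wordsSS h n s : s \in words h.+1 n.+1 <-> exists m u v,
  [/\ m <= n, u \in words h m, v \in words h.+1 (n - m) & s = glue u v].
Proof.
have lt_u m u : perm_eq u (iota 0 m) -> forall a, a \in u -> a < size u.
  by move=> um a; rewrite (perm_mem um) (perm_size um) size_iota mem_iota.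
split=> [/mem_words[sn av dec]|[m [u [v [le_mn]]]]].
  have [m [u [v [le_mn um vn e]]]] := unglue sn av; exists m, u, v.
  move: av dec; rewrite e => /(avoids312_glue _ (lt_u _ _ um))[av_u av_v].
  move=> /(dec_le_glue _ (lt_u _ _ um))[dec_u dec_v].
  by split=> //; apply/mem_words.
move=> /mem_words[um av_u dec_u] /mem_words[vn av_v dec_v] ->.
apply/mem_words; split; first exact: perm_glue le_mn um vn.
  exact/(avoids312_glue _ (lt_u _ _ um)).
exact/(dec_le_glue _ (lt_u _ _ um)).
Qed.

Lemma big_words (R : Type) (idx : R) (op : Monoid.com_law idx) h n F :
  \big[op/idx]_(s <- words h.+1 n.+1) F s = \big[op/idx]_(m < n.+1)
    \big[op/idx]_(s <- words h m) \big[op/idx]_(t <- words h.+1 (n - m))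
      F (glue s t).
Proof.
apply: (@big_glue _ _ _ _ glue size (words h) (words h.+1)); try exact: uniq_words.
- exact: size_mem_words.
- by move=> m m' s t s' t' _ _ /glue_inj.
- exact: mem_wordsSS.
Qed.

(** * Dyck paths and their first return *)

(** Stepwise test that a path from ordinate [y] stays between 0 and [h] and ends at 0. The free
    starting ordinate makes induction on the path possible. *)
Fixpoint walk (h y : nat) (w : seq bool) : bool :=
  match w with
  | [::] => y == 0
  | true :: w' => (y < h) && walk h y.+1 w'
  | false :: w' => (0 < y) && walk h y.-1 w'
  end.

Lemma ycoord_cons b w t :
  ycoord (b :: w) t.+1 = ((if b then 1 else - 1) + ycoord w t)%R.
Proof. by rewrite /ycoord /=; case: b => /=; lia. Qed.

Lemma walkP h y w : y <= h ->
  walk h y w <->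
  (forall t, t <= size w -> (0 <= y%:Z + ycoord w t <= h%:Z)%R) /\
  (y%:Z + ycoord w (size w) = 0)%R.
Proof.
elim: w y => [|b w IH] y le_yh.
  rewrite /= /ycoord /=; split=> [/eqP -> | [_ /eqP]]; last by lia.
  by split=> // t _; rewrite /=; lia.
have y_b t : (y%:Z + ycoord (b :: w) t.+1 =
    y%:Z + (if b then 1 else - 1) + ycoord w t)%R by rewrite ycoord_cons GRing.addrA.
have y_0 : ycoord (b :: w) 0 = 0%R by rewrite /ycoord.
have step y' : y' <= h -> (y'%:Z = y%:Z + (if b then 1 else - 1))%R ->
    (forall t, t <= size (b :: w) -> (0 <= y%:Z + ycoord (b :: w) t <= h%:Z)%R) /\
    (y%:Z + ycoord (b :: w) (size (b :: w)) = 0)%R <-> walk h y' w.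
  move=> le_y'h e; rewrite IH // e; split=> -[H1 H2]; split; rewrite -?y_b //.
  - by move=> t le_t; rewrite -y_b; apply: H1.
  - by move=> [|t] le_t; rewrite ?y_0 ?y_b; [lia | apply: H1].
  - by rewrite /= y_b.
case: b y_b y_0 step => y_b y_0 step /=.
  case: ltnP => [lt_yh|le_hy] /=; first by rewrite (step y.+1) //; lia.
  (* An up-step from ordinate [h] violates the upper bound at time 1. *)
  by split=> // -[/(_ 1)]; rewrite y_b /ycoord take0 /=; lia.
case: posnP => [y0|y_gt0] /=; last by rewrite (step y.-1); lia.
by split=> // -[/(_ 1)]; rewrite y_b /ycoord take0 /=; lia.
Qed.

Lemma walk_dyck h w : walk h 0 w = is_dyck w && (path_height w <= h).
Proof.
apply/idP/andP => [/walkP[//|H e]|[/andP[/forallP H /eqP e] /bigmax_leqP h_w]].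
  split.
    apply/andP; split; last by rewrite -e; apply/eqP; lia.
    by apply/forallP => t; have := H t; rewrite -ltnS ltn_ord; lia.
  by apply/bigmax_leqP => t _; have := H t; rewrite -ltnS ltn_ord; lia.
apply/walkP => //; split=> [t|]; last by rewrite e.
rewrite -ltnS => lt_t; have := H (Ordinal lt_t).
by have := h_w (Ordinal lt_t) isT; rewrite /=; lia.
Qed.

(** Raised by one, [u] ends at ordinate 1; the down-step then reaches 0, where [v] starts. *)
Lemma walk_cat h y u v :
  walk h y u -> walk h.+1 0 v -> walk h.+1 y.+1 (u ++ false :: v).
Proof.
elim: u y => [|b u IH] y /=; first by move=> /eqP ->.
case: b => /andP[H /IH{}IH] /IH{}IH; first by rewrite ltnS H.
by case: y H IH.
Qed.

(** The cut is at the first return to 0: until then the ordinate is at least 1, and lowering by one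
    gives [u]. *)
Lemma walk_split h y w : walk h.+1 y.+1 w -> y <= h ->
  exists u v, [/\ w = u ++ false :: v, walk h y u & walk h.+1 0 v].
Proof.
elim: w y => [|[] w IH] y //=.
  move=> /andP[lt_yh /IH[|u [v [-> wu wv]]]] //.
  by exists (true :: u), v; split=> //=; rewrite -ltnS lt_yh.
case: y => [|y] ww le_yh; first by exists [::], w.
have [u [v [-> wu wv]]] := IH _ ww (ltnW le_yh).
by exists (false :: u), v.
Qed.

(** Each first part ends at 0, from where a walk cannot step down, so neither first part is a proper
    prefix of the other. *)
Lemma walk_cat_inj h h' y u v u' v' : walk h y u -> walk h' y u' ->
  u ++ false :: v = u' ++ false :: v' -> u = u' /\ v = v'.
Proof.
elim: u u' y => [|b u IH] [|b' u'] y /=.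
- by move=> _ _ [].
- by move=> /eqP -> wu' [e _]; move: wu'; rewrite -e.
- by move=> wu /eqP y0 [e _]; move: wu; rewrite e y0.
move=> wu wu' [e /IH{}IH]; rewrite -e in wu' *.
by case: b {e} wu wu' => /andP[_ /IH{}IH] /andP[_ /IH[-> ->]].
Qed.

(** Each step flips the parity of the ordinate; hence the parts of a first-return decomposition have
    even length. *)
Lemma walk_parity h y w : walk h y w -> odd (size w) = odd y.
Proof.
elim: w y => [|[] w IH] y /=; first by move=> /eqP ->.
  by move=> /andP[_ /IH ->] /=; rewrite negbK.
by case: y => // y /IH -> /=.
Qed.

Definition dycks (h n : nat) : seq (seq bool) :=
  [seq val w | w : n.*2.-tuple bool <-
    enum [set w : n.*2.-tuple bool | is_dyck w & path_height w <= h]].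

Lemma size_dycks h n : size (dycks h n) = dyck_le h n.
Proof. by rewrite size_map -cardE. Qed.

Lemma uniq_dycks h n : uniq (dycks h n).
Proof. by rewrite map_inj_uniq ?enum_uniq //; apply: val_inj. Qed.

Lemma mem_dycks h n w : w \in dycks h n = (size w == n.*2) && walk h 0 w.
Proof.
rewrite walk_dyck; apply/mapP/andP => [[u]|[sz_w ww]].
  by rewrite mem_enum inE => uu ->; rewrite size_tuple.
by exists (Tuple sz_w); rewrite ?mem_enum ?inE.
Qed.

Lemma dyck_le_n0 h : dyck_le h 0 = 1.
Proof.
rewrite -size_dycks.
suff -> : dycks h 0 = [:: [::]] by [].
apply: perm_small_eq => //; apply: uniq_perm; rewrite ?uniq_dycks // => w.
by rewrite mem_dycks inE; case: w.
Qed.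

Lemma dyck_le_0S n : dyck_le 0 n.+1 = 0.
Proof.
rewrite -size_dycks; case: (dycks _ _) (@mem_dycks 0 n.+1) => // w l /(_ w).
by rewrite mem_head; case: w => [|[] w] //; rewrite andbF.
Qed.

(** First-return decomposition: up-step, [u], down-step, [v]. As [u] runs one level higher, its
    height bound drops by one. *)
Lemma dyck_le_SS h n :
  dyck_le h.+1 n.+1 = \sum_(m < n.+1) dyck_le h m * dyck_le h.+1 (n - m).
Proof.
rewrite -size_dycks -sum1_size.
rewrite (@big_glue _ _ _ _ (fun u v => true :: u ++ false :: v)
  (fun u => (size u)./2) (dycks h) (dycks h.+1) _ n) /=.
- apply: eq_bigr => m _; under eq_bigr do rewrite sum1_size.
  by rewrite big_const_seq iter_addn addn0 count_predT !size_dycks mulnC.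
- exact: uniq_dycks.
- exact: uniq_dycks.
- exact: uniq_dycks.
- by move=> m w; rewrite mem_dycks => /andP[/eqP -> _]; rewrite doubleK.
- move=> m m' u v u' v'; rewrite !mem_dycks => /andP[_ wu] /andP[_ wu'] [].
  exact: walk_cat_inj wu wu'.
move=> w; rewrite mem_dycks; split=> [/andP[sz_w]|[m [u [v [le_mn]]]]].
  case: w sz_w => [|[] w] //= sz_w /walk_split[] // u [v [e wu wv]].
  have odd_u := walk_parity wu; have odd_v := walk_parity wv; subst w.
  exists (size u)./2, u, v; rewrite !mem_dycks wu wv !andbT.
  rewrite size_cat /= in sz_w.
  have := odd_double_half (size u); have := odd_double_half (size v).
  by rewrite odd_u odd_v /=; split=> //; (try apply/eqP); lia.
rewrite !mem_dycks => /andP[/eqP sz_u wu] /andP[/eqP sz_v wv] ->.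
rewrite /= walk_cat // andbT size_cat /= sz_u sz_v; lia.
Qed.

(** Cutting words at the 0 and paths at the first return gives the same recursion and initial
    values. *)
Lemma size_words h n : size (words h n) = dyck_le h n.
Proof.
elim/ltn_ind: n h => -[|n] IH h; first by rewrite words_nil dyck_le_n0.
case: h => [|h]; first by rewrite words0S dyck_le_0S.
rewrite -sum1_size big_words dyck_le_SS; apply: eq_bigr => m _.
under eq_bigr do rewrite sum1_size.
rewrite big_const_seq iter_addn addn0 count_predT mulnC !IH ?ltnS ?leq_subr //.
by rewrite -ltnS ltn_ord.
Qed.

(** * Coefficients of power series *)

Section Fps.
Import GRing.Theory.
Local Open Scope ring_scope.
Variable R : comNzRingType.
Implicit Type f : fps R.

Lemma fps_coef_constM (c : R) f n : (c%:S * f)`_[n] = c * f`_[n].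
Proof.
rewrite fps_coefM big_ord_recl /= subn0 big1 ?addr0 // => i _.
by rewrite mul0r.
Qed.

Lemma fps_coef_varX i n : ('z ^+ i : fps R)`_[n] = (n == i)%:R.
Proof.
elim: i n => [|i IH] n; first by rewrite expr0 fps_coef1.
by rewrite exprS fps_coef_varM; case: n.
Qed.

Lemma fps_coef_sum I (r : seq I) P (F : I -> fps R) n :
  (\sum_(i <- r | P i) F i)`_[n] = \sum_(i <- r | P i) (F i)`_[n].
Proof. by elim/big_ind2: _ => // [|f a g b <- <-]; [case: n | ]. Qed.

End Fps.

(** * Weights and generating functions *)

Section Weight.
Import GRing.Theory.
Local Open Scope ring_scope.
Variables (R : comNzRingType) (x q : R).

Definition cell (a j : nat) : R := if a == j then x else if (j < a)%N then q else 1.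

(* In [weight i j s] the entry v of s at index l is compared, after raising it
   by i, with the position j + l. *)
Fixpoint weight (i j : nat) (s : seq nat) : R :=
  if s is v :: s' then cell (v + i) j * weight i j.+1 s' else 1.

Lemma weight_cat i j s t :
  weight i j (s ++ t) = weight i j s * weight i (j + size s) t.
Proof.
elim: s j => [|v s IH] j /=; first by rewrite mul1r addn0.
by rewrite IH mulrA addSnnS.
Qed.

Lemma weight_raise d i j s : weight i j (map (addn d) s) = weight (i + d) j s.
Proof. by elim: s j => //= v s IH j; rewrite IH [(d + v)%N]addnC -addnA [(d + i)%N]addnC. Qed.

(** Values and positions move together, so every comparison is preserved. *)
Lemma weight_slide d i j s : weight i (j + d) (map (addn d) s) = weight i j s.
Proof.
elim: s j => //= v s IH j; rewrite -addSn IH; congr (_ * _).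
by rewrite /cell -addnA [(d + _)%N]addnC eqn_add2r ltn_add2r.
Qed.

(** The 0 counts as value [i] at position [size s]. The part [s] keeps its positions with values one
    higher; for [t], values and positions both advance by [size s + 1]. *)
Lemma weight_glue i s t :
  weight i 0 (glue s t) = cell i (size s) * weight i.+1 0 s * weight i 0 t.
Proof.
rewrite /glue weight_cat (weight_raise 1) addn1 size_map /=.
by rewrite -[weight i 0 t](weight_slide (size s).+1) !add0n mulrCA mulrA.
Qed.

(** All positions are below [i], hence below the shifted values, so every entry is an excedance. *)
Lemma weight_exc i j s : (j + size s <= i)%N -> weight i j s = q ^+ size s.
Proof.
elim: s j => //= v s IH j le_ji; rewrite IH ?exprS; last by rewrite addSnnS.
by rewrite /cell; case: eqP => [|_]; [lia | case: ltnP => //; lia].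
Qed.

Lemma weight_prod i j s :
  weight i j s = \prod_(0 <= l < size s) cell (nth 0%N s l + i) (j + l).
Proof.
elim: s j => [|v s IH] j /=; first by rewrite big_nil.
rewrite big_nat_recl // IH addn0; congr (_ * _).
by apply: eq_bigr => l _; rewrite addSnnS.
Qed.

Lemma weight_word n (p : 'S_n) : weight 0 0 (word p) = x ^+ fp p * q ^+ exc p.
Proof.
rewrite weight_prod size_word big_mkord /fp /exc -!prodr_const.
rewrite [X in X * _]big_mkcond [X in _ * X]big_mkcond -big_split.
apply: eq_bigr => i _; rewrite nth_word addn0 add0n !inE /cell /= -val_eqE /=.
by case: ltngtP; rewrite ?mul1r ?mulr1.
Qed.

(** The series [W_i^h]. *)
Definition words_series (h i : nat) : fps R :=
  Fps (fun n => \sum_(s <- words h n) weight i 0 s).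

Lemma words_series_small h i n : (n <= i)%N ->
  (words_series h i)`_[n] = (dyck_le h n)%:R * q ^+ n.
Proof.
move=> le_ni; rewrite /= (eq_big_seq (fun=> q ^+ n)) => [|s /size_mem_words sz_s].
  by rewrite big_const_seq count_predT size_words iter_addr_0 mulr_natl.
by rewrite weight_exc sz_s.
Qed.

(** The factor [H]: the part before the 0, of size [m], weighted together with the 0 itself. *)
Definition first_series (h i : nat) : fps R :=
  Fps (fun m => cell i m * (words_series h i.+1)`_[m]).

(** The 0 contributes [x] in degree [i], [q] below it and 1 above it. The corrections by [x - 1] and
    [q - 1] thus stay in degrees at most [i], where [words_series_small] gives the coefficients. *)
Lemma first_seriesE h i : first_series h i =
  (x%:S - 1) * (dyck_le h i)%:R * q%:S ^+ i * 'z ^+ i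
  + (q%:S - 1) * dyck_series_lt h i (q%:S * 'z) + words_series h i.+1.
Proof.
apply/fpsP => m; rewrite !fps_coefD.
have subS (c : R) : c%:S - 1 = (c - 1)%:S by rewrite rmorphB rmorph1.
have natS n : n%:R = (n%:R : R)%:S by rewrite rmorph_nat.
rewrite !subS natS -rmorphXn -!rmorphM !fps_coef_constM fps_coef_varX.
rewrite /dyck_series_lt fps_coef_sum.
under eq_bigr => j _ do
  rewrite exprMn natS -rmorphXn mulrA -rmorphM fps_coef_constM fps_coef_varX.
have -> : \sum_(j < i) (dyck_le h j)%:R * q ^+ j * (m == j)%:R =
    if (m < i)%N then (dyck_le h m)%:R * q ^+ m else 0.
  case: ltnP => [lt_mi|le_im].
    rewrite (bigD1 (Ordinal lt_mi)) //= eqxx mulr1 big1 ?addr0 // => j.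
    by rewrite -val_eqE eq_sym /= => /negPf ->; rewrite mulr0.
  rewrite big1 // => j _; case: eqP => [e|_]; last by rewrite mulr0.
  by have := ltn_ord j; rewrite -e ltnNge le_im.
have -> : (first_series h i)`_[m] = cell i m * (words_series h i.+1)`_[m] by [].
rewrite /cell eq_sym; case: ltngtP => [lt_mi|lt_im|->].
- by rewrite words_series_small ?(leq_trans (ltnW lt_mi)) // mulr0n; ring.
- by rewrite mulr0n; ring.
- by rewrite words_series_small // mulr1n; ring.
Qed.

Lemma words_series0 i : words_series 0 i = 1.
Proof.
apply/fpsP => -[|n]; first by rewrite /= words_nil big_seq1.
by rewrite /= words0S big_nil.
Qed.

(** For a nonempty word, ['z] marks the 0 and the two other factors the parts around it. *)
Lemma words_seriesS h i : words_series h.+1 i =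
  1 + 'z * (first_series h i * words_series h.+1 i).
Proof.
apply/fpsP => n; rewrite fps_coefD fps_coef1 fps_coef_varM.
case: n => [|n]; first by rewrite /= words_nil big_seq1 addr0.
rewrite add0r fps_coefM /= big_words; apply: eq_bigr => m _.
rewrite [cell i m * _]mulr_sumr mulr_suml; apply: eq_big_seq => s /size_mem_words sz_s.
by rewrite mulr_sumr; apply: eq_bigr => t _; rewrite weight_glue sz_s.
Qed.

Lemma A_fromE k d i : (i + d)%N = k -> A_from x q k d i = words_series d i.
Proof.
elim: d i => [|d IH] i e /=; first by rewrite words_series0.
rewrite IH ?addSnnS // /A_step.
have -> : (k - i - 1)%N = d by lia.
(* Since [1 - 'z * H] is a unit, it suffices that its product with [words_series] is 1, which is
   [words_seriesS] rearranged. *)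
rewrite -first_seriesE; apply: (canLR (mulrK (fps_unit_1subz _))).
by rewrite mulrBr mulr1 {1}words_seriesS [words_series _ _ * _]mulrC -mulrA addrK.
Qed.

Lemma F_avoidE k : F_avoid x q [:: pat312; pat_decr k.+1] = words_series k 0.
Proof.
apply/fpsP => n; rewrite /= /words big_map big_enum /=.
by apply: eq_bigr => p _; rewrite weight_word.
Qed.

End Weight.

Theorem theorem4p5 (k : nat) :
  F_avoid xvar qvar [:: pat312; pat_decr k.+1] = A_series xvar qvar k 0.
Proof. by rewrite F_avoidE /A_series A_fromE // subn0. Qed.
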